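(* Let $a,c$ be nonzero complex numbers and let $\ell,m,n$ be nonnegative integers. Then $$ {}_4\phi_3\left[\begin{matrix}q^{\ell}a,\,c,\,q^{-n},\,-q^{-m-n}\\ \sqrt{qac},\,-q^{\ell}\sqrt{qac},\,q^{-m-2n}\end{matrix};q,q\right] =\frac{(q^{\ell}a,\,\sqrt{qa/c};q)_\ell}{(q^{\ell}a/c,\,\sqrt{qac};q)_\ell}\sum_{i=0}^{\ell}\sum_{j=0}^{m}T_{i,j}, $$ where $$ T_{i,j}=(-1)^j q^{\frac{5i}{2}-nj+\binom{j+1}{2}}\,\frac{1}{(ac)^{i/2}}\,\frac{1-q^{2\ell-2i}a/c}{1-q^{2\ell}a/c}\, \frac{(q^{-\ell},\,c,\,q^{-2\ell}c/a;q)_i}{(q,\,q^{1-2\ell}/a,\,q^{1-\ell}c/a;q)_i} $$ $$ \times\frac{(q^{-m},q^{-m-n},-q^{-m-n},q^{2\ell-i}a,q^{i}c;q)_j}{(q,\,q^{\ell}\sqrt{qac},\,-q^{\ell}\sqrt{qac},\,q^{-m-2n},\,q^{j-2m-2n-1};q)_j}\, \frac{(q^{1+2\ell-i+j}a,\,q^{1+i+j}c;q^2)_{m+n-j}}{(q,\,q^{1+2\ell+2j}ac;q^2)_{m+n-j}}. $$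
   Context: $q$ is a nonzero complex number. For complex $x$ and an integer $n\ge 0$, the $q$-shifted factorial is $(x;q)_0=1$, $(x;q)_n=\prod_{k=0}^{n-1}(1-xq^k)$, and $(x_1,\dots,x_r;q)_n=\prod_{s=1}^r (x_s;q)_n$ (likewise with base $q^2$ in place of $q$). The basic hypergeometric series is ${}_4\phi_3\left[\begin{matrix}a_0,a_1,a_2,a_3\\ b_1,b_2,b_3\end{matrix};q,z\right]=\sum_{k\ge0}\frac{(a_0,a_1,a_2,a_3;q)_k}{(q,b_1,b_2,b_3;q)_k}z^k$. Here one upper parameter is $q^{-n}$, so the series terminates and means the sum over $0\le k\le n$. Parameters are assumed to be such that no zero factor appears in a denominator of the displayed expressions. Square roots $q^{1/2},a^{1/2},c^{1/2}$ are fixed once and for all and used multiplicatively: $\sqrt{qac}=q^{1/2}a^{1/2}c^{1/2}$, $\sqrt{qa/c}=q^{1/2}a^{1/2}/c^{1/2}$, $(ac)^{i/2}=(a^{1/2}c^{1/2})^i$, $q^{5i/2}=(q^{1/2})^{5i}$. *)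

(* Defs.v *)
From mathcomp Require Import all_boot all_order all_algebra.
From mathcomp Require Import reals complex.

Set Implicit Arguments.
Unset Strict Implicit.
Unset Printing Implicit Defensive.

Import GRing.Theory.

Local Open Scope ring_scope.

Section QSeries.
Variable F : fieldType.
Implicit Types (x q z a c sq sa sc : F) (us ls : seq F) (i j k l m n : nat).

(** The q-shifted factorial (x; q)_n. *)
Definition qpoch x q n : F := \prod_(k < n) (1 - x * q ^+ k).

(** (x_1, ..., x_r; q)_n *)
Definition qpochs (xs : seq F) q n : F := \prod_(x <- xs) qpoch x q n.

(** The basic hypergeometric series with upper parameters [us] and lower
    parameters [ls], where [size us = (size ls).+1], summed over 0 <= k <= n:
    this is the meaning of the series when one upper parameter is q^(-n). *)
Definition qhyper_trunc n us ls q z : F :=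
  \sum_(k < n.+1) qpochs us q k / qpochs (q :: ls) q k * z ^+ k.

(** The summand T_{i,j}.  [sq], [sa], [sc] stand for the chosen square roots of
    [q], [a], [c].  Exponents of [q] that may be negative are computed in [int];
    [m + n - j] is a natural number subtraction, exact since [j <= m]. *)
Definition Tterm q a c sq sa sc l m n i j : F :=
  (-1) ^+ j * (sq ^+ (5 * i) * q ^ ('C(j.+1, 2)%:Z - (n * j)%:Z))
  * (1 / (sa * sc) ^+ i)
  * ((1 - q ^ ((2 * l)%:Z - (2 * i)%:Z) * a / c)
     / (1 - q ^+ (2 * l) * a / c))
  * (qpochs [:: q ^ (- l%:Z); c; q ^ (- (2 * l)%:Z) * c / a] q i
     / qpochs [:: q; q ^ (1 - (2 * l)%:Z) / a; q ^ (1 - l%:Z) * c / a] q i)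
  * (qpochs [:: q ^ (- m%:Z); q ^ (- m%:Z - n%:Z); - q ^ (- m%:Z - n%:Z);
               q ^ ((2 * l)%:Z - i%:Z) * a; q ^+ i * c] q j
     / qpochs [:: q; q ^+ l * (sq * sa * sc); - (q ^+ l * (sq * sa * sc));
                 q ^ (- m%:Z - (2 * n)%:Z);
                 q ^ (j%:Z - (2 * m)%:Z - (2 * n)%:Z - 1)] q j)
  * (qpochs [:: q ^ (1 + (2 * l)%:Z - i%:Z + j%:Z) * a; q ^+ (1 + i + j) * c]
       (q ^+ 2) (m + n - j)
     / qpochs [:: q; q ^+ (1 + 2 * l + 2 * j) * a * c] (q ^+ 2) (m + n - j)).

End QSeries.

(* Main.v *)
Require Import Defs.
From mathcomp Require Import all_boot all_order all_algebra ring zify.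
From mathcomp Require Import reals complex.

Set Implicit Arguments.
Unset Strict Implicit.
Unset Printing Implicit Defensive.

Import GRing.Theory.

Local Open Scope ring_scope.

(** Both summation indices come from one terminating very-well-poised 6phi5
    sum, [wp_sum], in which a parameter r satisfies r^2 = A q, so that its
    factors (r)_k / (A q / r)_k cancel.

    Taken with r = sqrt(q a / c), it expands (sqrt(q a c) q^k; q)_l in the
    products (q^(l+k) a; q)_(l-i) (q^k c; q)_i.  Each single term of the series
    becomes a combination over i of terms of the l = 0 series with a, c replaced
    by q^(2l-i) a, q^i c.

    Taken with r = q^(-m-n), it writes the l = 0 series as a combination over j
    of m = 0 series with a, c replaced by q^j a, q^j c and n by m + n - j; these
    are summed by Andrews' q-analogue of Watson's theorem, [watson_sum].

    Both closed forms follow by WZ telescoping.  The nonvanishing hypotheses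
    imply q^e <> 1 for 0 < e <= 2 (m + n), so no intermediate denominator
    vanishes and no density argument is needed. *)

(** * Elementary rules for q-shifted factorials *)

Section QPoch.
Variable F : fieldType.
Implicit Types (x q : F) (k n : nat).

Lemma qpoch0 x q : qpoch x q 0 = 1.
Proof. by rewrite /qpoch big_ord0. Qed.

Lemma qpochS x q n : qpoch x q n.+1 = qpoch x q n * (1 - x * q ^+ n).
Proof. by rewrite /qpoch big_ord_recr. Qed.

Lemma qpoch1 x q : qpoch x q 1 = 1 - x.
Proof. by rewrite qpochS qpoch0 mul1r expr0 mulr1. Qed.

Lemma qpochD x q k n :
  qpoch x q (k + n) = qpoch x q k * qpoch (x * q ^+ k) q n.
Proof.
rewrite /qpoch big_split_ord; congr (_ * _).
by apply: eq_bigr => i _; rewrite /= exprD mulrA.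
Qed.

Lemma qpochSl x q n : qpoch x q n.+1 = (1 - x) * qpoch (x * q) q n.
Proof. by rewrite -add1n qpochD qpoch1 expr1. Qed.

Lemma qpoch_neq0P x q n :
  reflect (forall k, (k < n)%N -> 1 - x * q ^+ k != 0) (qpoch x q n != 0).
Proof.
rewrite /qpoch; apply: (iffP (prodf_neq0 _ _)) => [H k kn|H i _]; last exact: H.
exact: (H (Ordinal kn)).
Qed.

End QPoch.

(** * The terminating very-well-poised 6phi5 sum *)

Section WellPoised.
Variable F : fieldType.
Variables (q r D E : F).

(** These are the upper parameters q^(-n) and r E / D, the lower parameter r D / E and the argument
    q^n D / E of the 6phi5, all multiplied by E^n (r D / E; q)_n. *)
Definition wp_num n k :=
  \prod_(0 <= t < k) (q ^+ n - q ^+ t) * \prod_(0 <= t < k) (D - r * E * q ^+ t)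
  * \prod_(k <= t < n) (E - r * D * q ^+ t).

(* With A = r^2 / q, the last two factors are (A q^k; q)_(n+1) / (1 - A q^(2k)),
   written so as to stay meaningful when A = 1.  The parameters D and E
   homogenise the sum, which avoids dividing by quantities that may vanish. *)
Definition wp_term n k :=
  wp_num n k / (qpoch q q k * qpoch (r ^+ 2 * q ^+ k.-1) q k
                  * qpoch (r ^+ 2 * q ^+ (2 * k)) q (n - k)).

(** The two runs of factors in [wp_term] stop at exponent 2k and restart at 2k + 2. Inserting the
    skipped exponent 2k + 1 merges them into one run of n + 1 factors, which is easier to shift in n
    and k. *)
Lemma wp_termS n k : (k < n)%N -> 1 - r ^+ 2 * q ^+ (2 * k + 1) != 0 ->
  wp_term n k.+1
  = wp_num n k.+1 * (1 - r ^+ 2 * q ^+ (2 * k + 1))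
    / (qpoch q q k.+1 * qpoch (r ^+ 2 * q ^+ k) q n.+1).
Proof.
move=> kn h; rewrite /wp_term /=.
have -> : qpoch (r ^+ 2 * q ^+ k) q n.+1
  = qpoch (r ^+ 2 * q ^+ k) q k.+1 * ((1 - r ^+ 2 * q ^+ (2 * k + 1))
    * qpoch (r ^+ 2 * q ^+ (2 * k.+1)) q (n - k.+1)).
  have -> : n.+1 = (k.+1 + (1 + (n - k.+1)))%N by rewrite add1n addnS subnKC.
  rewrite (qpochD _ _ k.+1) (qpochD _ _ 1) qpoch1 -!mulrA -!exprD.
  have -> : (k + k.+1 = 2 * k + 1)%N by lia.
  by have -> : (k + (k.+1 + 1) = 2 * k.+1)%N by lia.
move: (1 - _ * _) h (qpoch _ _ _) (qpoch _ _ _) (qpoch _ _ _) => u u0 X Y Z.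
rewrite (_ : Z * (Y * (u * X)) = Z * Y * X * u :> F); last by ring.
by rewrite -mulf_div divff // mulr1.
Qed.

Lemma prod_geom_shift n k :
  \prod_(0 <= t < k.+1) (q ^+ n.+1 - q ^+ t)
  = (q ^+ n.+1 - 1) * q ^+ k * \prod_(0 <= t < k) (q ^+ n - q ^+ t).
Proof.
rewrite big_nat_recl //= expr0 -mulrA; congr (_ * _).
elim: k => [|k IH]; first by rewrite !big_nil mulr1.
by rewrite !big_nat_recr //= IH !exprS; ring.
Qed.

(** The summand is the defect of the first-order recurrence in n that the closed form of [wp_sum]
    satisfies. It has an explicit antidifference in K, so induction on K leaves only a rational
    identity. *)
Lemma wp_telescope n K : (K <= n)%N ->
  (forall k, (k <= n)%N -> 1 - q ^+ k.+1 != 0) ->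
  (forall k, (k <= 2 * n)%N -> 1 - r ^+ 2 * q ^+ k != 0) ->
  1 - r * q ^+ n != 0 ->
  \sum_(0 <= k < K.+1) (wp_term n.+1 k
      - (E - D * q ^+ n) / (1 - r * q ^+ n) * wp_term n k)
  = q ^+ n * (D - r * E * q ^+ K) * (1 - r * q ^+ K)
    / ((1 - r ^+ 2 * q ^+ K * q ^+ n) * (1 - r * q ^+ n))
    * (wp_num n K / (qpoch q q K * qpoch (r ^+ 2 * q ^+ K) q n)).
Proof.
move=> Kn hq hr hrn; elim: K Kn => [|K IH] Kn.
  rewrite big_nat1 /wp_term /wp_num !big_nil !qpoch0 !muln0 !expr0 !mulr1 !mul1r !subn0.
  rewrite qpochS big_nat_recr //=.
  have : qpoch (r ^+ 2) q n != 0.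
    by apply/qpoch_neq0P => k kn; apply: hr; rewrite mul2n -addnn (leq_trans (ltnW kn)) ?leq_addr.
  have := hr n; rewrite mul2n -addnn leq_addr => /(_ isT).
  move: (qpoch _ _ _) (q ^+ n) (\prod_(_ <= i < _) _) hrn => P y W h1 h2 h3.
  by field; rewrite h1 h2 h3.
have h6 : 1 - r ^+ 2 * q ^+ (2 * K + 1) != 0 by apply: hr; lia.
rewrite big_nat_recr //= IH 1?ltnW // (wp_termS Kn h6) (@wp_termS n.+1 _ (ltnW Kn) h6).
rewrite /wp_num prod_geom_shift !big_nat_recr //= (big_ltn Kn).
(* Since K < n, n is a successor, and every run of factors reduces to the common (r^2 q^(K+1); q)_n
   for the new n. *)
case: n Kn hq hr hrn {IH} => // n Kn hq hr hrn.
rewrite [qpoch _ _ n.+3]qpochS [qpoch _ _ n.+2]qpochS.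
rewrite [qpoch (r ^+ 2 * q ^+ K) q n.+1]qpochSl.
rewrite [qpoch (r ^+ 2 * q ^+ K.+1) q n.+1]qpochS.
rewrite -[r ^+ 2 * q ^+ K * q]mulrA -exprSr [qpoch q q K.+1]qpochS.
have h1 : qpoch q q K != 0.
  by apply/qpoch_neq0P => k kn; rewrite -exprS; apply: hq; lia.
have h2 : qpoch (r ^+ 2 * q ^+ K.+1) q n != 0.
  by apply/qpoch_neq0P => k kn; rewrite -mulrA -exprD; apply: hr; lia.
have h3 := hq K (ltnW Kn).
have h4 : 1 - r ^+ 2 * q ^+ (K + n.+1) != 0 by apply: hr; lia.
have h5 : 1 - r ^+ 2 * q ^+ (K.+1 + n.+1) != 0 by apply: hr; lia.
have h7 : 1 - r ^+ 2 * q ^+ K != 0 by apply: hr; lia.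
move: h1 h2 (\prod_(_ <= i < _) _) (\prod_(_ <= i < _) _) (\prod_(_ <= i < _) _).
move: (qpoch _ _ _) (qpoch _ _ _) h3 h4 h5 h6 h7 hrn.
rewrite mul2n -addnn !exprD expr1 !(exprS q).
move: (q ^+ n) (q ^+ K) => y x P Q h3 h4 h5 h6 h7 hrn h1 h2 A B C.
field.
rewrite h1 h2 h3 hrn h7 /= andbT; apply/andP; split.
  by rewrite (_ : 1 - _ = 1 - r ^+ 2 * (x * (q * y))) //; ring.
by rewrite (_ : 1 - _ = 1 - r ^+ 2 * (q * x * (q * y))) //; ring.
Qed.

Lemma wp_sum n :
  (forall k, (k < n)%N -> 1 - q ^+ k.+1 != 0) ->
  (forall k, (k < (2 * n).-1)%N -> 1 - r ^+ 2 * q ^+ k != 0) ->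
  \sum_(0 <= k < n.+1) wp_term n k
  = \prod_(0 <= t < n) (E - D * q ^+ t) / qpoch r q n.
Proof.
elim: n => [|n IH] hq hr.
  by rewrite big_nat1 /wp_term /wp_num !big_nil !qpoch0 !mulr1.
have hr' k : (k <= 2 * n)%N -> 1 - r ^+ 2 * q ^+ k != 0.
  by move=> kn; apply: hr; lia.
have hrn : 1 - r * q ^+ n != 0.
  apply: contraNneq (hr' _ (leqnn _)) => h.
  rewrite mulnC exprM -exprMn (_ : _ - _ = (1 - r * q ^+ n) * (1 + r * q ^+ n)); last by ring.
  by rewrite h mul0r.
rewrite big_nat_recr //= [in RHS]big_nat_recr //= qpochS -mulf_div [RHS]mulrC -IH; last 2 first.
- by move=> k kn; apply: hq; lia.
- by move=> k kn; apply: hr'; lia.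
(* At K = n the telescoped sum is the opposite of the one extra term k = n + 1 of the longer sum. *)
rewrite big_distrr /=; apply/subr0_eq; rewrite addrAC -sumrB wp_telescope //.
rewrite /wp_term /wp_num subnn qpoch0 prod_geom_shift big_nat_recr //=.
rewrite (big_geq (leqnn n)) (big_geq (leqnn n.+1)) (qpochS q q n) [qpoch _ _ n.+1]qpochS.
have h1 : qpoch q q n != 0.
  by apply/qpoch_neq0P => k kn; rewrite -exprS; apply: hq; lia.
have h2 : qpoch (r ^+ 2 * q ^+ n) q n != 0.
  by apply/qpoch_neq0P => k kn; rewrite -mulrA -exprD; apply: hr'; lia.
have h3 := hq n (leqnn _).
have h4 := hr' _ (leqnn _).
move: hrn h1 h2 h3 h4 (\prod_(_ <= i < _) _) (\prod_(_ <= i < _) _).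
move: (qpoch _ _ _) (qpoch _ _ _); rewrite mul2n -addnn exprD !(exprS q).
move: (q ^+ n) => y P Q hrn h1 h2 h3 h4 A B.
field; rewrite h1 h2 hrn h3 andbT.
by rewrite andbT (_ : 1 - _ = 1 - r ^+ 2 * (y * y)) //; ring.
Qed.

End WellPoised.

(** * Andrews' q-analogue of Watson's theorem *)

Section Andrews.
Variable F : fieldType.
Variables (q a c : F).

(** The pairs of parameters x, -x of the 4phi3 are merged into (x^2; q^2)_k, so that no square root
    of z or of q a c is needed. *)
Definition watson_term z k :=
  qpoch a q k * qpoch c q k * qpoch z (q ^+ 2) k
  / (qpoch q q k * qpoch (q * a * c) (q ^+ 2) k * qpoch z q k) * q ^+ k.

(** With w = q^(-2N-2) one has w q^2 = q^(-2N), so this ties term k + 1 of the sum for N + 1 to term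
    k of the sum for N. *)
Lemma watson_term_shift w k : (forall i, (i <= k.+1)%N -> 1 - w * q ^+ i != 0) ->
  watson_term w k.+1
  = watson_term (w * q ^+ 2) k
    * (q * (1 - a * q ^+ k) * (1 - c * q ^+ k) * (1 - w * q * q ^+ k)
       / ((1 - q * q ^+ k) * (1 - q * a * c * (q ^+ k) ^+ 2) * (1 - w * q))).
Proof.
move=> hw; rewrite /watson_term.
have e : qpoch w q k.+1 * (1 - w * q * q ^+ k)
  = (1 - w) * (1 - w * q) * qpoch (w * q ^+ 2) q k.
  by rewrite -mulrA -exprS -qpochS !qpochSl -[w * q * q]mulrA mulrA -expr2.
have h0 := hw 0%N isT; rewrite expr0 mulr1 in h0.
have h1 := hw 1%N isT; rewrite expr1 in h1.
have h2 := hw k.+1 (leqnn _); rewrite exprS mulrA in h2.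
rewrite -[qpoch w q k.+1](mulfK h2) e {e} [qpoch w _ _]qpochSl.
rewrite !(qpochS _ _ k) -(exprM q 2) mulnC exprM [q ^+ k.+1]exprS.
rewrite !invfM !invrK.
move: (qpoch (w * q ^+ 2) q k)^-1 (qpoch q q k)^-1 (qpoch (q * a * c) _ k)^-1 => A B C.
move: (1 - q * _)^-1 (1 - _ * _ ^+ 2)^-1 => U V.
by field; rewrite h0 h1.
Qed.

Lemma watson_termS z k :
  watson_term z k.+1
  = watson_term z k
    * (q * (1 - a * q ^+ k) * (1 - c * q ^+ k) * (1 - z * (q ^+ k) ^+ 2)
       / ((1 - q * q ^+ k) * (1 - q * a * c * (q ^+ k) ^+ 2) * (1 - z * q ^+ k))).
Proof.
rewrite /watson_term !(qpochS _ _ k) -(exprM q 2) mulnC exprM [q ^+ k.+1]exprS !invfM.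
by ring.
Qed.

(* For w = q^(-2N-2) and K = N the factor 1 - w (q q^K)^2 vanishes: this gives
   the first-order recurrence in N. *)
Lemma watson_telescope w K : q != 0 -> w * q - a * c != 0 ->
  (forall k, (k <= K)%N -> 1 - q ^+ k.+1 != 0) ->
  (forall k, (k <= K)%N -> 1 - q * a * c * (q ^+ 2) ^+ k != 0) ->
  (forall k, (k <= K.+1)%N -> 1 - w * q ^+ k != 0) ->
  \sum_(0 <= k < K.+2) watson_term w k
  - (a - w * q) * (w * q - c) / ((1 - w * q) * (w * q - a * c))
    * \sum_(0 <= k < K.+1) watson_term (w * q ^+ 2) k
  = watson_term (w * q ^+ 2) K
    * (q * (1 - a * q ^+ K) * (1 - c * q ^+ K) * (1 - w * (q * q ^+ K) ^+ 2)
       * (w - a * c * q ^+ K)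
       / ((1 - w * q) * (w * q - a * c) * q ^+ K * (1 - q * q ^+ K)
          * (1 - q * a * c * (q ^+ K) ^+ 2))).
Proof.
move=> q0 hwac; elim: K => [|K IH] hq hac hw.
  rewrite big_nat1 !big_nat_recr //= big_geq // add0r watson_term_shift //.
  rewrite /watson_term !qpoch0 !expr0 !mulr1 invr1 !mulr1.
  move: (hq 0%N isT) (hac 0%N isT) (hw 1%N isT); rewrite expr0 !expr1 mulr1 => h1 h2 h3.
  by field; rewrite h1 h2 h3 hwac.
rewrite [X in X - _]big_nat_recr //= [X in _ - _ * X]big_nat_recr //= watson_term_shift //.
rewrite [X in _ - X]mulrDr opprD addrACA IH; last 3 first.
- by move=> k kK; apply: hq; lia.
- by move=> k kK; apply: hac; lia.
- by move=> k kK; apply: hw; lia.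
move=> {IH}.
rewrite !watson_termS.
move: (hq K (leqnSn _)) (hq K.+1 (leqnn _)) (hac K (leqnSn _)) (hac K.+1 (leqnn _)).
move: (hw 1%N isT) (hw K.+2 (leqnn _)).
rewrite [q ^+ 2 ^+ K]exprAC [q ^+ 2 ^+ K.+1]exprAC; move: (watson_term _ _) => t.
rewrite !(exprS q) expr0 mulr1.
have : q ^+ K != 0 by rewrite expf_neq0.
move: (q ^+ K) => x h1 h2 h3 h4 h5 h6 h7.
field.
by rewrite h1 h2 h4 h5 h6 h7 hwac q0 -[w * _ * x]mulrA -[q * q * x]mulrA h3.
Qed.

Lemma watson_sum N : q != 0 ->
  (forall k, (k < 2 * N)%N -> 1 - q ^+ k.+1 != 0) ->
  (forall k, (k < N)%N -> 1 - q * a * c * (q ^+ 2) ^+ k != 0) ->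
  \sum_(0 <= k < N.+1) watson_term (q ^- (2 * N)) k
  = qpoch (q * a) (q ^+ 2) N * qpoch (q * c) (q ^+ 2) N
    / (qpoch q (q ^+ 2) N * qpoch (q * a * c) (q ^+ 2) N).
Proof.
move=> q0; elim: N => [|N IH] hq hac.
  by rewrite big_nat1 /watson_term !qpoch0 !mulr1 invr1 !mulr1.
have qn0 k : q ^+ k != 0 by rewrite expf_neq0.
set w := q ^- (2 * N.+1).
have ew : w * q ^+ 2 = q ^- (2 * N).
  by rewrite /w mulnS exprD invfM mulrAC mulVf ?mul1r.
have ew2 : w * q ^+ 2 * q ^+ (2 * N) = 1 by rewrite ew mulVf.
have hw k : (k <= N.+1)%N -> 1 - w * q ^+ k != 0.
  move=> kN; apply: contraNneq (hq (2 * N.+1 - k).-1 _) => [/eqP|]; last by lia.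
  rewrite subr_eq0 prednK ?subn_gt0; last by lia.
  move=> /eqP h; rewrite subr_eq0; apply/eqP/(mulfI (qn0 k)).
  rewrite mulr1 -exprD subnKC; last by lia.
  by rewrite -[RHS]mul1r h mulrAC mulVf ?mul1r.
(* If w q = a c, then q a c q^(2N) = w q^2 q^(2N) = 1, against the factor k = N of [hac]. *)
have hwac : w * q - a * c != 0.
  apply: contraNneq (hac N (leqnn _)) => h.
  rewrite -exprM subr_eq0; apply/eqP.
  by rewrite -ew2 -[q * a * c]mulrA -(subr0_eq h); ring.
have hq' k : (k <= N)%N -> 1 - q ^+ k.+1 != 0 by move=> kN; apply: hq; lia.
have hac' k : (k <= N)%N -> 1 - q * a * c * (q ^+ 2) ^+ k != 0 by move=> kN; apply: hac.
have := watson_telescope q0 hwac hq' hac' hw.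
have wx : w * (q * q ^+ N) ^+ 2 = 1 by rewrite exprMn -exprM [(N * 2)%N]mulnC mulrA.
rewrite wx subrr mulr0 !mul0r mulr0 => /subr0_eq ->.
rewrite ew IH; last 2 first.
- by move=> k kN; apply: hq; lia.
- by move=> k kN; apply: hac; lia.
rewrite ![qpoch _ _ N.+1]qpochS -[in RHS]exprM.
have h1 : 1 - q ^+ (2 * N).+1 != 0 by apply: hq; lia.
have h2 := hac N (leqnn _).
have h3 := qn0 (2 * N)%N.
have -> : w = (q ^+ 2 * q ^+ (2 * N))^-1 by rewrite -exprD -mulnS.
move: h1 h2 h3; rewrite -exprM exprS !invfM.
move: (qpoch q _ _)^-1 (qpoch (q * a * c) _ _)^-1 (q ^+ (2 * N)) => A B y h1 h2 h3.
by field; rewrite -(opprB 1) oppr_eq0 h1 h2 h3 q0.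
Qed.

End Andrews.

(** * Rearranging finite sums *)

Lemma sum_triangle (V : nmodType) (f : nat -> nat -> V) M :
  \sum_(0 <= r < M.+1) \sum_(0 <= j < r.+1) f r j
  = \sum_(0 <= j < M.+1) \sum_(0 <= k < (M - j).+1) f (j + k)%N j.
Proof.
elim: M => [|M IH]; first by rewrite !big_nat1.
rewrite big_nat_recr //= IH [RHS]big_nat_recr //= subnn big_nat1 addn0.
rewrite [X in _ + X = _]big_nat_recr //= addrA -big_split /=; congr (_ + _).
apply: eq_big_nat => j /andP[_ jM].
by rewrite subSn // [in RHS]big_nat_recr //= addnS subnKC.
Qed.

(** The ranges k <= n and j <= m are cut off by (q^(-n); q)_k and (q^(-m); q)_j. Extending both to m
    + n makes the double sum triangular. *)
Lemma sum_widen (V : nmodType) (f : nat -> V) m M : (m <= M)%N ->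
  (forall k, (m < k)%N -> f k = 0) ->
  \sum_(0 <= k < m.+1) f k = \sum_(0 <= k < M.+1) f k.
Proof.
move=> mM f0; rewrite [RHS](big_cat_nat (n := m.+1)) //=.
rewrite [X in _ = _ + X]big1_seq ?addr0 // => k /andP[_].
by rewrite mem_index_iota => /andP[/f0].
Qed.

(** * The case l = 0: expansion over j *)

Section Watson.
Variable F : fieldType.
Variable q : F.
Hypothesis q0 : q != 0.

Lemma qpoch_sqr x n : qpoch x q n * qpoch (- x) q n = qpoch (x ^+ 2) (q ^+ 2) n.
Proof.
rewrite /qpoch -big_split; apply: eq_bigr => i _ /=.
by rewrite exprAC; ring.
Qed.

Lemma qpoch_eq0 n k : (n < k)%N -> qpoch (q ^- n) q k = 0.
Proof.
move=> nk; apply/eqP; rewrite /qpoch prodf_seq_eq0; apply/hasP.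
by exists (Ordinal nk); rewrite ?mem_index_enum //= mulVf ?subrr ?expf_neq0.
Qed.

Lemma prod_qpoch (d x : F) k :
  \prod_(0 <= t < k) (d - d * x * q ^+ t) = d ^+ k * qpoch x q k.
Proof.
rewrite /qpoch big_mkord -[in d ^+ k](card_ord k) -prodr_const -big_split.
by apply: eq_bigr => i _ /=; ring.
Qed.

Lemma prod_pow_sub n k : (k <= n)%N ->
  \prod_(0 <= t < k) (q ^+ n - q ^+ t) * qpoch q q (n - k)
  = (-1) ^+ k * q ^+ 'C(k, 2) * qpoch q q n.
Proof.
elim: k => [|k IH] kn; first by rewrite big_nil subn0 expr0 !mul1r.
have {IH} := IH (ltnW kn).
rewrite big_nat_recr //= -[(n - k)%N]prednK ?subn_gt0 // -subnS qpochS binS bin1.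
rewrite exprD exprS; have -> : q ^+ n = q ^+ k * (q * q ^+ (n - k.+1)).
  by rewrite -exprS -exprD; congr (q ^+ _); lia.
move: (\prod_(_ <= _ < _) _) (qpoch _ _ _) => P Q e.
transitivity (- q ^+ k * (P * (Q * (1 - q * q ^+ (n - k.+1))))); first by ring.
by rewrite e; ring.
Qed.

(** This is [wp_sum] of length k with r = q^(-m-n), D = q^(-n), E = 1: its right-hand product is
    (q^(-n); q)_k, and r = D q^(-m) turns the factors D - r E q^t into (q^(-m); q)_j, which cuts the
    sum off at j = m. *)
Lemma qpoch_expand m n k :
  (k <= m + n)%N -> (forall i, (i < 2 * (m + n))%N -> 1 - q ^+ i.+1 != 0) ->
  qpoch (q ^- n) q k / (qpoch q q k * qpoch (q ^- (m + n) * q ^- n) q k)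
  = qpoch (q ^- (m + n)) q k
    * \sum_(0 <= j < k.+1)
      ((-1) ^+ j * q ^+ 'C(j, 2) * q ^- n ^+ j * qpoch (q ^- m) q j
       / (qpoch q q j * qpoch (q ^- (m + n) * q ^- n) q j
          * qpoch (q ^- (m + n) ^+ 2 * q ^+ j.-1) q j)
       / (qpoch q q (k - j) * qpoch (q ^- (m + n) ^+ 2 * q ^+ (2 * j)) q (k - j))).
Proof.
move=> kM hq; set r := q ^- (m + n); set d := q ^- n.
have qn0 i : q ^+ i != 0 by rewrite expf_neq0.
have hpow e i : (i < e <= 2 * (m + n))%N -> 1 - q ^- e * q ^+ i != 0.
  move=> /andP[ie eM]; apply: contraNneq (hq (e - i).-1 _) => [/eqP|]; last by lia.
  rewrite subr_eq0 prednK ?subn_gt0 // => /eqP h.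
  rewrite subr_eq0; apply/eqP/(mulfI (qn0 i)).
  rewrite mulr1 -exprD subnKC; last by lia.
  by rewrite -[RHS]mul1r h mulrAC mulVf ?mul1r.
have hr i : (i < (2 * k).-1)%N -> 1 - r ^+ 2 * q ^+ i != 0.
  by move=> ik; rewrite /r -exprVn -exprM exprVn; apply: hpow; lia.
have hq' i : (i < k)%N -> 1 - q ^+ i.+1 != 0 by move=> ik; apply: hq; lia.
have hqk i : (i <= k)%N -> qpoch q q i != 0.
  by move=> ik; apply/qpoch_neq0P => t ti; rewrite -exprS; apply: hq; lia.
have hrd i : (i <= k)%N -> qpoch (r * d) q i != 0.
  move=> ik; apply/qpoch_neq0P => t ti; rewrite /r /d -invfM -exprD.
  by apply: hpow; lia.
have hrk : qpoch r q k != 0.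
  by apply/qpoch_neq0P => t ti; apply: hpow; lia.
have -> : qpoch d q k = \prod_(0 <= t < k) (1 - d * q ^+ t) by rewrite big_mkord.
rewrite -[\prod_(_ <= _ < _) _](divfK hrk) -(@wp_sum F q r d 1 k hq' hr).
rewrite [_ * qpoch r q k]mulrC -mulrA; congr (_ * _).
rewrite big_distrl; apply: eq_big_nat => j /andP[_ jk] /=.
rewrite /wp_term /wp_num.
have -> : \prod_(0 <= t < j) (d - r * 1 * q ^+ t) = d ^+ j * qpoch (q ^- m) q j.
  rewrite -prod_qpoch; apply: eq_bigr => t _.
  by rewrite mulr1 /d /r -invfM -exprD addnC.
have -> : \prod_(j <= t < k) (1 - r * d * q ^+ t) = qpoch (r * d) q k / qpoch (r * d) q j.
  apply: (canRL (mulfK (hrd j jk))).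
  by rewrite mulrC /qpoch -!(big_mkord xpredT (fun t => 1 - r * d * q ^+ t)) -big_cat_nat.
have hqkj : qpoch q q (k - j) != 0 by apply: hqk; lia.
rewrite -[\prod_(0 <= t < j) _](mulfK hqkj) prod_pow_sub //.
have := hqk _ (leqnn k); have := hrd _ (leqnn k); rewrite !invfM.
move: (qpoch (q ^- m) _ _) => B h1 h2.
move: (qpoch q q j)^-1 (qpoch q q (k - j))^-1 (qpoch (r * d) q j)^-1 => X Y Z.
move: (qpoch (r ^+ 2 * _) _ _)^-1 (qpoch (r ^+ 2 * _) _ _)^-1 => U V.
by field; rewrite h1 h2.
Qed.

(** The j-dependent part of T_{i,j}, where a, c, s will be q^(2l-i) a, q^i c, q^l sqrt(q a c). The
    last factor is the value of [watson_sum] at a q^j, c q^j and N = m + n - j. The truncated [j.-1]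
    is harmless at j = 0, where its product is empty. *)
Definition watson_coef a c s m n j : F :=
  (-1) ^+ j * q ^+ 'C(j, 2) * q ^- n ^+ j * q ^+ j
  * (qpoch (q ^- m) q j * qpoch (q ^- (m + n)) q j * qpoch (- q ^- (m + n)) q j
     * qpoch a q j * qpoch c q j
     / (qpoch q q j * qpoch s q j * qpoch (- s) q j
        * qpoch (q ^- (m + n) * q ^- n) q j
        * qpoch (q ^- (m + n) ^+ 2 * q ^+ j.-1) q j))
  * (qpoch (q * (a * q ^+ j)) (q ^+ 2) (m + n - j)
     * qpoch (q * (c * q ^+ j)) (q ^+ 2) (m + n - j)
     / (qpoch q (q ^+ 2) (m + n - j)
        * qpoch (q * (a * q ^+ j) * (c * q ^+ j)) (q ^+ 2) (m + n - j))).

(** Each term is expanded by [qpoch_expand], the triangular sum is exchanged, and the inner sum over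
    k - j is evaluated by [watson_sum]. *)
Lemma watson_expansion a c s m n : s ^+ 2 = q * a * c ->
  (forall i, (i < 2 * (m + n))%N -> 1 - q ^+ i.+1 != 0) ->
  (forall i, (i < m + n)%N -> 1 - q * a * c * (q ^+ 2) ^+ i != 0) ->
  \sum_(0 <= k < n.+1)
     qpoch a q k * qpoch c q k * qpoch (q ^- n) q k * qpoch (- q ^- (m + n)) q k
     / (qpoch q q k * qpoch s q k * qpoch (- s) q k
        * qpoch (q ^- (m + n) * q ^- n) q k) * q ^+ k
  = \sum_(0 <= j < m.+1)
     watson_coef a c s m n j.
Proof.
rewrite /watson_coef => s2 hq hac; set M := (m + n)%N; set r := q ^- M; set d := q ^- n.
set w := fun j : nat => (-1) ^+ j * q ^+ 'C(j, 2) * d ^+ j * qpoch (q ^- m) q j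
       / (qpoch q q j * qpoch (r * d) q j * qpoch (r ^+ 2 * q ^+ j.-1) q j).
set g := fun k : nat => qpoch a q k * qpoch c q k * qpoch r q k * qpoch (- r) q k
       / (qpoch s q k * qpoch (- s) q k) * q ^+ k.
rewrite (@sum_widen _ _ n M) ?leq_addl //; last first.
  by move=> k nk; rewrite /d qpoch_eq0 // mulr0 !mul0r.
rewrite [RHS](@sum_widen _ _ m M) ?leq_addr //; last first.
  by move=> j mj; rewrite qpoch_eq0 // !mul0r mulr0 mul0r.
transitivity (\sum_(0 <= k < M.+1) \sum_(0 <= j < k.+1)
    w j * (g k / (qpoch q q (k - j) * qpoch (r ^+ 2 * q ^+ (2 * j)) q (k - j)))).
  apply: eq_big_nat => k /andP[_ kM].
  transitivity (qpoch a q k * qpoch c q k * qpoch (- r) q k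
       / (qpoch s q k * qpoch (- s) q k) * q ^+ k
       * (qpoch d q k / (qpoch q q k * qpoch (r * d) q k))).
    by rewrite !invfM; ring.
  rewrite qpoch_expand // mulrA big_distrr /=; apply: eq_bigr => j _.
  by rewrite /w /g -/r -/d !invfM; ring.
rewrite sum_triangle; apply: eq_big_nat => j /andP[_ jM].
rewrite -big_distrr /=.
(* This z plays two roles: (r q^j)^2 comes from the shifted pair (r)_k (-r)_k, and r^2 q^(2j) is the
   base of the lower factorial of length k - j. Their agreement is what makes the inner series a
   Watson series. *)
set z := q ^- (2 * (M - j)).
have ez : (r * q ^+ j) ^+ 2 = z.
  have eM : q ^+ M = q ^+ (M - j) * q ^+ j by rewrite -exprD subnK.
  rewrite /r /z eM [(2 * _)%N]mulnC exprM.
  have := expf_neq0 j q0; have := expf_neq0 (M - j) q0.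
  move: (q ^+ j) (q ^+ (M - j)) => x y y0 x0.
  by field; rewrite x0 y0.
have es : (s * q ^+ j) ^+ 2 = q * (a * q ^+ j) * (c * q ^+ j).
  by rewrite exprMn s2; ring.
under eq_bigr => i _.
  rewrite addKn (_ : g (j + i)%N / _ = g j * watson_term q (a * q ^+ j) (c * q ^+ j) z i).
    over.
  rewrite /watson_term -es -[in qpoch z (q ^+ 2)]ez -!qpoch_sqr.
  have -> : r ^+ 2 * q ^+ (2 * j) = z by rewrite -ez exprMn -exprM mulnC.
  by rewrite /g !qpochD exprD -!mulNr !invfM; ring.
rewrite -big_distrr /= watson_sum //; first last.
- move=> k kM; rewrite (_ : _ * _ * _ * _ = q * a * c * (q ^+ 2) ^+ (k + j)).
    by apply: hac; rewrite /M in kM; lia.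
  by rewrite exprD [q ^+ 2 ^+ j]exprAC; ring.
- by move=> k kM; apply: hq; rewrite /M in kM; lia.
by rewrite /w /g !invfM; ring.
Qed.

End Watson.

(** * From l = 0 to general l: expansion over i *)

Section Raising.
Variable F : fieldType.
Variable q : F.
Hypothesis q0 : q != 0.

(** Extracting -q^t leaves 1 - x q^(l-1-t), and these factors run through (x; q)_(l-k) backwards. *)
Lemma prod_sub_rev x k l : (k <= l)%N ->
  \prod_(k <= t < l) (x * q ^+ l.-1 - q ^+ t)
  = \prod_(k <= t < l) (- q ^+ t) * qpoch x q (l - k).
Proof.
move=> kl; rewrite big_nat_rev [X in _ = X * _]big_nat_rev /=.
have -> : qpoch x q (l - k) = \prod_(k <= t < l) (1 - x * q ^+ (t - k)).
  rewrite -[X in \prod_(X <= _ < _) _]add0n big_addn big_mkord.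
  by apply: eq_bigr => t _; rewrite addnK.
rewrite -big_split /=; apply: eq_big_nat => t /andP[kt tl].
have -> : q ^+ l.-1 = q ^+ (k + l - t.+1) * q ^+ (t - k).
  by rewrite -exprD; congr (q ^+ _); lia.
by ring.
Qed.

Lemma prod_opp_pow k : \prod_(0 <= t < k) (- q ^+ t) = (-1) ^+ k * q ^+ 'C(k, 2).
Proof.
elim: k => [|k IH]; first by rewrite big_nil mul1r.
by rewrite big_nat_recr //= IH binS bin1 exprD exprS; ring.
Qed.

(** This is [wp_sum] with r = g, D = 1, E = g u q^(l-1): by [prod_sub_rev] its right-hand product is
    (g u; q)_l up to the nonzero product of the -q^t. *)
Lemma qpoch_raise g u l :
  (forall k, (k < l)%N -> 1 - q ^+ k.+1 != 0) ->
  (forall k, (k < (2 * l).-1)%N -> 1 - g ^+ 2 * q ^+ k != 0) ->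
  qpoch (g * u) q l
  = qpoch g q l * \sum_(0 <= k < l.+1)
      g ^+ (l - k) * qpoch q q l / (qpoch q q k * qpoch q q (l - k))
      * qpoch (g ^+ 2 * u * q ^+ l.-1) q k * qpoch u q (l - k)
      / (qpoch (g ^+ 2 * q ^+ k.-1) q k * qpoch (g ^+ 2 * q ^+ (2 * k)) q (l - k)).
Proof.
move=> hq hg.
have hgl : qpoch g q l != 0.
  apply/qpoch_neq0P => t tl; apply: contraNneq (hg (2 * t)%N _) => [h|]; last by lia.
  rewrite mulnC exprM -exprMn (_ : _ - _ = (1 - g * q ^+ t) * (1 + g * q ^+ t)); last by ring.
  by rewrite h mul0r.
pose S k l := \prod_(k <= t < l) (- q ^+ t).
have S0 k i : S k i != 0.
  by rewrite prodf_seq_neq0; apply/allP => t _ /=; rewrite oppr_eq0 expf_neq0.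
apply: (mulfI (S0 0%N l)).
have -> : S 0%N l * qpoch (g * u) q l
   = \prod_(0 <= t < l) (g * u * q ^+ l.-1 - 1 * q ^+ t).
  by under [RHS]eq_bigr do rewrite mul1r; rewrite prod_sub_rev // subn0.
rewrite -[LHS](divfK hgl) -(@wp_sum F q g 1 (g * u * q ^+ l.-1) l hq hg).
rewrite mulrC mulrCA; congr (_ * _).
rewrite big_distrr; apply: eq_big_nat => k /andP[_ kl] /=.
rewrite /wp_term /wp_num.
have hqk : qpoch q q (l - k) != 0.
  by apply/qpoch_neq0P => t tl; rewrite -exprS; apply: hq; lia.
have -> : \prod_(0 <= t < k) (1 - g * (g * u * q ^+ l.-1) * q ^+ t)
  = qpoch (g ^+ 2 * u * q ^+ l.-1) q k.
  by rewrite big_mkord; apply: eq_bigr => t _; ring.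
have -> : \prod_(k <= t < l) (g * u * q ^+ l.-1 - g * 1 * q ^+ t)
  = g ^+ (l - k) * (S k l * qpoch u q (l - k)).
  rewrite -prod_sub_rev // -prodr_const_nat -big_split /=.
  by apply: eq_bigr => t _; ring.
have -> : S 0%N l = S 0%N k * S k l by rewrite /S -big_cat_nat.
rewrite -[\prod_(0 <= t < k) _](mulfK hqk) prod_pow_sub // {2}/S prod_opp_pow !invfM.
by ring.
Qed.

(** [qpoch_raise] gives factorials indexed by l - i, while T_{i,j} uses factorials of length i. Both
    sides agree at i = 0 and have the same ratio of consecutive values. Here e stands for a / c. *)
Lemma raising_coef (a e g : F) l i : a != 0 -> e != 0 -> (i <= l)%N ->
  (forall k, (k < l)%N -> 1 - q ^+ k.+1 != 0) ->
  (forall k, (k <= 2 * l)%N -> 1 - e * q ^+ k != 0) ->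
  (forall k, (k < l)%N -> 1 - q ^+ l * a * q ^+ k != 0) ->
  qpoch (q ^+ l * a) q l / qpoch (q ^+ l * e) q l.+1 * (q ^+ 2 * g / a) ^+ i
    * (qpoch (q ^- l) q i * qpoch (q ^- (2 * l) / e) q i
       / (qpoch (q * q ^- (2 * l) / a) q i * qpoch (q * q ^- l / e) q i))
  = qpoch (q ^+ l * a) q (l - i) * g ^+ i * qpoch q q l
    / (qpoch q q (l - i) * qpoch (e * q ^+ (l - i)) q l.+1).
Proof.
move=> a0 e0 il hq he ha.
have hqk k : (k <= l)%N -> qpoch q q k != 0.
  by move=> kl; apply/qpoch_neq0P => t tl; rewrite -exprS; apply: hq; lia.
have hek k : (k <= l)%N -> qpoch (e * q ^+ k) q l.+1 != 0.
  by move=> kl; apply/qpoch_neq0P => t tl; rewrite -mulrA -exprD; apply: he; lia.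
elim: i il => [|i IH] il.
  rewrite !qpoch0 !expr0 !subn0 !mulr1 invr1 !mulr1 [q ^+ l * e]mulrC.
  by field; rewrite hqk // hek.
move: (IH (ltnW il)); rewrite !(qpochS _ _ i) !(exprSr _ i).
have -> : (l - i)%N = (l - i.+1).+1 by lia.
set k := (l - i.+1)%N.
have hqS := qpochS q q k; rewrite hqS.
rewrite [qpoch (q ^+ l * a) q k.+1]qpochS.
have ek : qpoch (e * q ^+ k) q l.+1
  = qpoch (e * q ^+ k.+1) q l.+1 * ((1 - e * q ^+ k) / (1 - e * q ^+ (k + l.+1))).
  have h := he (k + l.+1)%N; rewrite exprD mulrA in h.
  have {}h : 1 - e * q ^+ k * q ^+ l.+1 != 0 by apply: h; lia.
  have : qpoch (e * q ^+ k) q l.+2 = (1 - e * q ^+ k) * qpoch (e * q ^+ k.+1) q l.+1.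
    by rewrite qpochSl -mulrA -exprSr.
  by rewrite qpochS exprD [e * (_ * _)]mulrA mulrA [_ * (1 - e * q ^+ k)]mulrC => <-; rewrite mulfK.
(* Separates the value at i, given by the induction hypothesis, from the ratio of step i to i +
   1. *)
have split A B K P Q R S z p p' r s :
    A / B * (K * z) * (P * p * (Q * p') / (R * r * (S * s)))
    = A / B * K * (P * Q / (R * S)) * (z * p * p' / (r * s)) :> F.
  by rewrite !invfM; ring.
rewrite ek split => ->.
have h1 : 1 - q * q ^+ k != 0 by rewrite -exprS; apply: hq; lia.
have h2 : qpoch (e * q ^+ k.+1) q l.+1 != 0 by apply: hek; lia.
have h3 : 1 - e * q ^+ k != 0 by apply: he; lia.
have h4 : 1 - e * q ^+ (k + l.+1) != 0 by apply: he; lia.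
have h5 : 1 - q ^+ l * a * q ^+ k != 0 by apply: ha; lia.
have h6 : qpoch q q k != 0 by apply: hqk; lia.
have h7 : q ^+ k != 0 by rewrite expf_neq0.
have h8 : q ^+ i != 0 by rewrite expf_neq0.
move: h1 h3 h4 h5 h7 h8; rewrite mul2n -addnn !exprD exprS.
have -> : q ^+ l = q * q ^+ k * q ^+ i by rewrite -exprS -exprD; congr (q ^+ _); lia.
move: (g ^+ i) (q ^+ i) (q ^+ k) (qpoch _ _ l) h6 h2 => G x y T h6 h2.
move=> h1 h3 h4 h5 h7 h8; field.
rewrite -(opprB 1 (y * e)) oppr_eq0 [y * e]mulrC.
rewrite (_ : _ * a - 1 = - (1 - q * y * x * a * y)); last by ring.
by rewrite oppr_eq0 h1 h2 h3 h4 h5 h6 h7 h8 e0 a0 q0.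
Qed.

(** The part of T_{i,j} that depends on i alone: for g = sqrt(q a / c), q^2 g / a is q^(5/2) / (a
    c)^(1/2). *)
Definition raise_coef a c g l i : F :=
  (q ^+ 2 * g / a) ^+ i
  * ((1 - a / c * q ^+ (2 * (l - i))) / (1 - a / c * q ^+ (2 * l)))
  * (qpoch (q ^- l) q i * qpoch c q i * qpoch (q ^- (2 * l) / (a / c)) q i
     / (qpoch q q i * qpoch (q * q ^- (2 * l) / a) q i
        * qpoch (q * q ^- l / (a / c)) q i)).

(** Taking u = c q^k in [qpoch_raise] produces (q^(l+k) a; q)_(l-i) (c q^k; q)_i, because g^2 c = q
    a. These join (q^l a; q)_k (c; q)_k, and splitting the joined runs the other way shifts the
    parameters to q^(2l-i) a and q^i c. *)
Lemma raising (a c g : F) l k : a != 0 -> c != 0 -> g ^+ 2 = q * (a / c) ->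
  (forall i, (i < l)%N -> 1 - q ^+ i.+1 != 0) ->
  (forall i, (i <= 2 * l)%N -> 1 - a / c * q ^+ i != 0) ->
  (forall i, (i < l)%N -> 1 - q ^+ l * a * q ^+ i != 0) ->
  qpoch (q ^+ l * a) q k * qpoch c q k * qpoch (g * c * q ^+ k) q l
  = qpoch (q ^+ l * a) q l * qpoch g q l / qpoch (q ^+ l * (a / c)) q l
    * \sum_(0 <= i < l.+1)
      raise_coef a c g l i
      * (qpoch (q ^+ (2 * l - i) * a) q k * qpoch (q ^+ i * c) q k).
Proof.
move=> a0 c0 g2 hq he ha; pose e := a / c; rewrite -/e in g2 he *.
have e0 : e != 0 by rewrite mulf_neq0 ?invr_neq0.
rewrite -[g * c * _]mulrA (@qpoch_raise g (c * q ^+ k) l) //; last first.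
  move=> i il; rewrite g2 [q * e]mulrC -mulrA -exprS; apply: he; lia.
rewrite mulrCA !big_distrr /= big_nat_rev; apply: eq_big_nat => i /andP[_ il] /=.
rewrite add0n subSS subKn // /raise_coef -/e; set K := (l - i)%N.
rewrite ltnS in il; have rc := raising_coef g a0 e0 il hq he ha.
have e2l : 1 - e * q ^+ (2 * l) != 0 by apply: he.
(* Since g^2 = q e, inserting 1 - e q^(2K) between the two runs of [qpoch_raise] gives the single
   run of [raising_coef]. *)
have eK : qpoch (e * q ^+ K) q l.+1
  = qpoch (g ^+ 2 * q ^+ K.-1) q K * (1 - e * q ^+ (2 * K))
    * qpoch (g ^+ 2 * q ^+ (2 * K)) q i.
  rewrite (_ : l.+1 = K + (1 + i))%N; last by lia.
  rewrite (qpochD _ _ K) (qpochD _ _ 1) qpoch1 g2 expr1 mulrA; congr (_ * _ * _).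
  - by case: (K) => [|k1]; rewrite ?qpoch0 //= exprS; congr qpoch; ring.
  - by rewrite mul2n -addnn exprD mulrA.
  - by rewrite mul2n -addnn exprD; congr qpoch; ring.
have aK : qpoch (q ^+ l * a) q K * qpoch (q ^+ (2 * l - i) * a) q k
  = qpoch (q ^+ l * a) q k * qpoch (g ^+ 2 * (c * q ^+ k) * q ^+ l.-1) q K.
  rewrite (_ : 2 * l - i = l + K)%N; last by lia.
  rewrite exprD [_ * q ^+ K * a]mulrAC -qpochD addnC qpochD; congr (_ * _).
  (* K = 0 includes l = 0, where [l.-1] is truncated; both products are then empty. *)
  case: (posnP K) => [->|K0]; first by rewrite !qpoch0.
  congr qpoch; rewrite g2 /e -[in LHS](prednK (n := l)) ?exprS; last by lia.
  by field.
have cK : qpoch c q i * qpoch (q ^+ i * c) q k = qpoch c q k * qpoch (c * q ^+ k) q i.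
  by rewrite [q ^+ i * c]mulrC -!qpochD addnC.
have el : qpoch (q ^+ l * e) q l.+1 = qpoch (q ^+ l * e) q l * (1 - e * q ^+ (2 * l)).
  by rewrite qpochS mul2n -addnn exprD; congr (_ * (1 - _)); ring.
have u0 : 1 - e * q ^+ (2 * K) != 0 by apply: he; rewrite leq_mul2l leq_subr orbT.
rewrite el -/K eK in rc.
set lhs := (X in X = _) in rc; set u := 1 - e * q ^+ (2 * K) in rc u0 *.
transitivity (qpoch g q l * lhs * (u / qpoch q q i)
    * (qpoch c q i * qpoch (q ^+ i * c) q k) * qpoch (q ^+ (2 * l - i) * a) q k).
  rewrite rc cK.
  transitivity (qpoch g q l * g ^+ i * qpoch q q l * (qpoch c q k * qpoch (c * q ^+ k) q i)
     * (qpoch (q ^+ l * a) q K * qpoch (q ^+ (2 * l - i) * a) q k)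
     * (u / (qpoch q q K * (qpoch (g ^+ 2 * q ^+ K.-1) q K * u
           * qpoch (g ^+ 2 * q ^+ (2 * K)) q i) * qpoch q q i))); last first.
    by rewrite !invfM; ring.
  have cancel X Y Z W : u / (X * (Y * u * Z) * W) = (X * (Y * Z) * W)^-1.
    by rewrite !invfM; move: (X^-1) (Y^-1) (Z^-1) (W^-1) => *; field.
  by rewrite aK cancel !invfM; ring.
by rewrite /lhs !invfM; ring.
Qed.

End Raising.

(** * Factorisation of the summand T_{i,j} *)

Section Summand.
Variable F : fieldType.
Variable q : F.
Hypothesis q0 : q != 0.

Lemma qpochs_neq0 xs p k x t :
  qpochs xs p k != 0 -> x \in xs -> (t < k)%N -> 1 - x * p ^+ t != 0 :> F.
Proof.
rewrite /qpochs prodf_seq_neq0 => /allP h /h /= /qpoch_neq0P; exact.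
Qed.

Lemma exprz_subn (z : int) (k t : nat) : z = k%:Z - t%:Z -> q ^ z = q ^+ k / q ^+ t.
Proof. by move=> ->; rewrite expfzDr // -exprnN. Qed.

(** Separates the two expansions: the index j enters only through the l = 0 coefficient at the
    shifted parameters. *)
Lemma TtermE (a c sq sa sc : F) l m n i j :
  a != 0 -> c != 0 -> sq ^+ 2 = q -> sa ^+ 2 = a -> sc ^+ 2 = c ->
  (i <= l)%N -> (j <= m)%N ->
  Tterm q a c sq sa sc l m n i j
  = raise_coef q a c (sq * sa / sc) l i
    * watson_coef q (q ^+ (2 * l - i) * a) (q ^+ i * c) (q ^+ l * (sq * sa * sc)) m n j.
Proof.
move=> a0 c0 sqE saE scE il jm.
have sa0 : sa != 0 by apply: contraNneq a0 => h; rewrite -saE h expr0n.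
have sc0 : sc != 0 by apply: contraNneq c0 => h; rewrite -scE h expr0n.
rewrite /Tterm /raise_coef /watson_coef /qpochs !big_cons !big_nil !mulr1.
have -> : q ^ (- l%:Z) = q ^- l by rewrite exprnN.
have -> : q ^ (- m%:Z) = q ^- m by rewrite exprnN.
have -> : q ^ (- m%:Z - n%:Z) = q ^- (m + n).
  by rewrite (@exprz_subn _ 0 (m + n)) ?expr0 ?mul1r //; lia.
have -> : q ^ (- m%:Z - (2 * n)%:Z) = q ^- (m + n) * q ^- n.
  by rewrite (@exprz_subn _ 0 (m + n + n)) ?expr0 ?mul1r ?exprD ?invfM //; lia.
have -> : q ^ (- (2 * l)%:Z) * c / a = q ^- (2 * l) / (a / c).
  by rewrite -exprnN invf_div mulrA.
have -> : q ^ (1 - (2 * l)%:Z) = q * q ^- (2 * l) by rewrite (@exprz_subn _ 1 (2 * l)).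
have -> : q ^ (1 - l%:Z) * c / a = q * q ^- l / (a / c).
  by rewrite (@exprz_subn _ 1 l) // invf_div mulrA.
have -> : q ^ ((2 * l)%:Z - i%:Z) = q ^+ (2 * l - i).
  by rewrite (@exprz_subn _ (2 * l - i) 0) ?expr0 ?divr1 //; lia.
have -> : q ^ ((2 * l)%:Z - (2 * i)%:Z) * a / c = a / c * q ^+ (2 * (l - i)).
  rewrite (@exprz_subn _ (2 * (l - i)) 0); last by lia.
  by rewrite expr0 divr1 -mulrA mulrC.
have -> : q ^+ (2 * l) * a / c = a / c * q ^+ (2 * l) by rewrite -mulrA mulrC.
have -> : qpoch (q ^ (j%:Z - (2 * m)%:Z - (2 * n)%:Z - 1)) q j
   = qpoch (q ^- (m + n) ^+ 2 * q ^+ j.-1) q j.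
  case: (posnP j) => [->|j0]; first by rewrite !qpoch0.
  congr qpoch; rewrite (@exprz_subn _ j.-1 (2 * (m + n))); last by lia.
  by rewrite mulrC [in RHS]exprVn -exprM [(_ * 2)%N]mulnC.
have -> : q ^ ('C(j.+1, 2)%:Z - (n * j)%:Z) = q ^+ 'C(j, 2) * q ^- n ^+ j * q ^+ j.
  rewrite (@exprz_subn _ 'C(j.+1, 2) (n * j)) // binS bin1 exprD.
  by rewrite [in RHS]exprVn -exprM mulrAC.
have -> : q ^ (1 + (2 * l)%:Z - i%:Z + j%:Z) * a = q * (q ^+ (2 * l - i) * a * q ^+ j).
  rewrite (@exprz_subn _ (1 + (2 * l - i) + j) 0) ?expr0 ?divr1; last by lia.
  by rewrite !exprD; ring.
have -> : q ^+ (1 + i + j) * c = q * (q ^+ i * c * q ^+ j) by rewrite !exprD; ring.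
have -> : q ^+ (1 + 2 * l + 2 * j) * a * c
   = q * (q ^+ (2 * l - i) * a * q ^+ j) * (q ^+ i * c * q ^+ j).
  have -> : (1 + 2 * l + 2 * j = 1 + ((2 * l - i) + i) + (j + j))%N by lia.
  by rewrite !exprD; ring.
have -> : q ^+ 2 * (sq * sa / sc) / a = sq ^+ 5 / (sa * sc).
  by rewrite -sqE -saE; field; rewrite sa0 sc0.
rewrite [in X in _ = X]expr_div_n -exprM !invfM.
by ring.
Qed.

End Summand.

(** * Nonvanishing conditions and assembly of the double sum *)

Theorem mainTheorem3 (R : realType) (q a c sq sa sc : complex R) (l m n : nat)
  (q_neq0 : q != 0) (a_neq0 : a != 0) (c_neq0 : c != 0)
  (sqE : sq ^+ 2 = q) (saE : sa ^+ 2 = a) (scE : sc ^+ 2 = c)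
  (* nonvanishing of the denominators: left-hand side *)
  (den_lhs : forall k : nat, (k <= n)%N ->
     qpochs [:: q; sq * sa * sc; - (q ^+ l * (sq * sa * sc));
               q ^ (- m%:Z - (2 * n)%:Z)] q k != 0)
  (* prefactor of the double sum *)
  (den_pre : qpochs [:: q ^+ l * a / c; sq * sa * sc] q l != 0)
  (* the terms T_{i,j} *)
  (den_T0 : 1 - q ^+ (2 * l) * a / c != 0)
  (den_T1 : forall i : nat, (i <= l)%N ->
     qpochs [:: q; q ^ (1 - (2 * l)%:Z) / a; q ^ (1 - l%:Z) * c / a] q i != 0)
  (den_T2 : forall j : nat, (j <= m)%N ->
     qpochs [:: q; q ^+ l * (sq * sa * sc); - (q ^+ l * (sq * sa * sc));
               q ^ (- m%:Z - (2 * n)%:Z);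
               q ^ (j%:Z - (2 * m)%:Z - (2 * n)%:Z - 1)] q j != 0)
  (den_T3 : forall j : nat, (j <= m)%N ->
     qpochs [:: q; q ^+ (1 + 2 * l + 2 * j) * a * c]
       (q ^+ 2) (m + n - j) != 0) :
  qhyper_trunc n
    [:: q ^+ l * a; c; q ^ (- n%:Z); - q ^ (- m%:Z - n%:Z)]
    [:: sq * sa * sc; - (q ^+ l * (sq * sa * sc)); q ^ (- m%:Z - (2 * n)%:Z)]
    q q
  = qpochs [:: q ^+ l * a; sq * sa / sc] q l
    / qpochs [:: q ^+ l * a / c; sq * sa * sc] q l
    * \sum_(i < l.+1) \sum_(j < m.+1) Tterm q a c sq sa sc l m n i j.
Proof.
have q0 := q_neq0.
have qne (z : int) k t : (t < k)%N -> z = 0%:Z - k%:Z ->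
    1 - q ^ z * q ^+ t != 0 -> q ^+ (k - t) != 1.
  move=> tk -> h; apply: contraNneq h => h.
  rewrite (@exprz_subn _ _ q0 _ 0 k) // expr0 mul1r -(subnK (ltnW tk)) exprD h mul1r.
  by rewrite mulVf ?subrr ?expf_neq0.
have q1 e : (0 < e <= 2 * (m + n))%N -> q ^+ e != 1.
  (* The last factor of (q^(j-2m-2n-1); q)_j has exponent -2 (m + n + 1 - j). *)
  have even_large e' : (n < e' <= m + n)%N -> q ^+ (2 * e') != 1.
    move=> he; have hj : (m + n + 1 - e' <= m)%N by lia.
    have := den_T2 _ hj; set j := (_ - e')%N => h.
    have := qpochs_neq0 h (x := q ^ (j%:Z - (2 * m)%:Z - (2 * n)%:Z - 1)) (t := j.-1).
    rewrite !inE eqxx !orbT => /(_ isT) h1.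
    have := @qne _ (2 * m + 2 * n + 1 - j)%N j.-1 _ _ (h1 _).
    rewrite (_ : 2 * m + 2 * n + 1 - j - j.-1 = 2 * e')%N; last by lia.
    by apply; lia.
  move=> /andP[e0 eM].
  (* Odd e comes from (q; q^2)_(m+n), e <= n from (q; q)_n, n < e <= m + n from q^(2e) <> 1, m + n <
     e <= 2n from (q^(-m-2n); q)_n, and the remaining even e from [even_large] at e / 2 > n. *)
  have [o|ev] := boolP (odd e).
    have := qpochs_neq0 (den_T3 0%N (leq0n _)) (x := q) (t := e./2).
    rewrite inE eqxx -exprM -exprS subr_eq0 eq_sym => h.
    by rewrite -[e]odd_double_half o add1n -mul2n; apply: h => //; lia.
  have [en|ne] := leqP e n.
    have := qpochs_neq0 (den_lhs _ (leqnn n)) (x := q) (t := e.-1).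
    by rewrite inE eqxx -exprS prednK // subr_eq0 eq_sym; apply.
  have [eMn|Mne] := leqP e (m + n).
    apply: contraNneq (even_large e _) => [h|]; last by rewrite ne.
    by rewrite mulnC exprM h expr1n.
  have [e2n|n2e] := leqP e (2 * n).
    have := qpochs_neq0 (den_lhs _ (leqnn n)) (x := q ^ (- m%:Z - (2 * n)%:Z))
      (t := (m + 2 * n - e)%N).
    rewrite !inE eqxx !orbT => /(_ isT) h1.
    have := @qne _ (m + 2 * n)%N (m + 2 * n - e)%N _ _ (h1 _).
    by rewrite subKn; [apply; lia | lia].
  have -> : e = (2 * e./2)%N by rewrite mul2n even_halfK.
  by apply: even_large; lia.
have hq k : (k < 2 * (m + n))%N -> 1 - q ^+ k.+1 != 0.
  by move=> kM; rewrite subr_eq0 eq_sym q1.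
have hql k : (k < l)%N -> 1 - q ^+ k.+1 != 0.
  by move=> kl; rewrite exprS; apply: (qpochs_neq0 (den_T1 _ (leqnn l))) => //; rewrite inE eqxx.
have inv_neq (x y : complex R) : x != 0 -> y != 0 -> 1 - x / y != 0 -> 1 - y / x != 0.
  move=> x0 y0; apply: contraNneq => /subr0_eq h.
  by rewrite -invf_div -h invr1 subrr.
(* Three sources: k = 2l is [den_T0], k < l is (q^(1-l) c / a; q)_l read backwards through
   [inv_neq], and l <= k < 2l is the prefactor (q^l a / c; q)_l. *)
have he k : (k <= 2 * l)%N -> 1 - a / c * q ^+ k != 0.
  rewrite leq_eqVlt => /predU1P[->|kl]; first by rewrite mulrC mulrA.
  have [kl'|lk] := ltnP k l.
    rewrite mulrAC; apply: inv_neq; rewrite ?mulf_neq0 ?expf_neq0 //.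
    have := qpochs_neq0 (den_T1 _ (leqnn l)) (x := q ^ (1 - l%:Z) * c / a) (t := (l - k.+1)%N).
    rewrite !inE eqxx !orbT (_ : q ^ _ * c / a * _ = c / (a * q ^+ k)).
      by apply => //; lia.
    rewrite (@exprz_subn _ _ q0 _ 1 l) // expr1.
    have -> : q ^+ l = q * q ^+ k * q ^+ (l - k.+1) by rewrite -exprS -exprD subnKC.
    by field; rewrite a_neq0 q0 !expf_neq0.
  rewrite (_ : _ * _ = q ^+ l * a / c * q ^+ (k - l)).
    by apply: (qpochs_neq0 den_pre); rewrite ?inE ?eqxx //; lia.
  by rewrite -{1}(subnKC lk) exprD; ring.
have ha k : (k < l)%N -> 1 - q ^+ l * a * q ^+ k != 0.
  move=> kl; rewrite -[_ * _]divr1; apply: inv_neq; rewrite ?oner_neq0 ?mulf_neq0 ?expf_neq0 //.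
  have := qpochs_neq0 (den_T1 _ (leqnn l)) (x := q ^ (1 - (2 * l)%:Z) / a) (t := (l - k.+1)%N).
  rewrite !inE eqxx !orbT (_ : q ^ _ / a * _ = 1 / (q ^+ l * a * q ^+ k)).
    by apply => //; lia.
  rewrite (@exprz_subn _ _ q0 _ 1 (2 * l)) // expr1 mul2n -addnn exprD.
  have -> : q ^+ l = q * q ^+ k * q ^+ (l - k.+1) by rewrite -exprS -exprD subnKC.
  by field; rewrite a_neq0 q0 !expf_neq0.
have hac k : (k < m + n)%N -> 1 - q ^+ (1 + 2 * l) * a * c * (q ^+ 2) ^+ k != 0.
  move=> kM; have := den_T3 0%N (leq0n _); rewrite muln0 addn0 subn0 => h.
  by apply: (qpochs_neq0 h) => //; rewrite !inE eqxx orbT.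
set s := sq * sa * sc in den_lhs den_pre den_T2 *.
have s2 : s ^+ 2 = q * a * c by rewrite /s !exprMn sqE saE scE.
pose s' := q ^+ l * s.
(* Since s'^2 = q^(1+2l) a c, each factor of (q^(1+2l) a c; q^2)_(m+n) is a multiple of 1 - s'
   q^t. *)
have s'k k : (k <= m + n)%N -> qpoch s' q k != 0.
  move=> kM; apply/qpoch_neq0P => t tk.
  have := hac t (leq_trans tk kM); apply: contraNneq => h.
  apply/eqP; transitivity ((1 - s' * q ^+ t) * (1 + s' * q ^+ t)); last by rewrite h mul0r.
  rewrite exprAC [(1 + 2 * l)%N]addnC mul2n -addnn !exprD expr1 /s'.
  move: (q ^+ l) (q ^+ t) => y x.
  transitivity (1 - (q * a * c) * y ^+ 2 * x ^+ 2); first by ring.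
  by rewrite -s2; ring.
have sl : qpoch s q l != 0.
  by move: den_pre; rewrite /qpochs !big_cons big_nil mulr1 mulf_eq0 negb_or => /andP[].
have sk k : (k <= n)%N -> qpoch s q k != 0.
  move=> kn; have := den_lhs _ kn; rewrite /qpochs !big_cons !mulf_eq0 !negb_or.
  by case/and3P.
transitivity (qpoch (q ^+ l * a) q l * qpoch (sq * sa / sc) q l
    / (qpoch (q ^+ l * (a / c)) q l * qpoch s q l)
    * \sum_(0 <= i < l.+1) raise_coef q a c (sq * sa / sc) l i
      * \sum_(0 <= j < m.+1)
        watson_coef q (q ^+ (2 * l - i) * a) (q ^+ i * c) s' m n j); last first.
  have qpochs2 x y : qpochs [:: x; y] q l = qpoch x q l * qpoch y q l.
    by rewrite /qpochs big_cons big_seq1.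
  rewrite !qpochs2 [q ^+ l * (a / c)]mulrA; congr (_ * _).
  rewrite big_mkord; apply: eq_bigr => i _; rewrite big_mkord big_distrr.
  by apply: eq_bigr => j _ /=; rewrite TtermE // -ltnS.
transitivity (\sum_(0 <= k < n.+1)
    qpoch (q ^- n) q k * qpoch (- q ^- (m + n)) q k * q ^+ k
    / (qpoch q q k * qpoch (- s') q k * qpoch (q ^- (m + n) * q ^- n) q k * qpoch s' q k)
    * (qpoch (q ^+ l * a) q l * qpoch (sq * sa / sc) q l
    / (qpoch (q ^+ l * (a / c)) q l * qpoch s q l)
    * \sum_(0 <= i < l.+1) raise_coef q a c (sq * sa / sc) l i
      * (qpoch (q ^+ (2 * l - i) * a) q k * qpoch (q ^+ i * c) q k))).
  rewrite /qhyper_trunc big_mkord; apply: eq_bigr => k _.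
  have sc0 : sc != 0 by apply: contraNneq c_neq0 => h; rewrite -scE h expr0n.
  have g2 : (sq * sa / sc) ^+ 2 = q * (a / c).
    by rewrite expr_div_n exprMn sqE saE scE mulrA.
  have := raising q0 k a_neq0 c_neq0 g2 hql he ha.
  have -> : sq * sa / sc * c = s by rewrite -scE /s; field.
  set S := \sum_(0 <= i < l.+1) _; move=> rk.
  have kn : (k <= n)%N by rewrite -ltnS.
  (* This trades the lower parameter s for s' = q^l s at the price of (s q^k; q)_l in the numerator,
     which is the factor [raising] expands. *)
  have ss : qpoch s q k * qpoch (s * q ^+ k) q l = qpoch s q l * qpoch s' q k.
    by rewrite -qpochD addnC qpochD [s * _]mulrC.
  transitivity (qpoch (q ^- n) q k * qpoch (- q ^- (m + n)) q k * q ^+ k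
    / (qpoch q q k * qpoch (- s') q k * qpoch (q ^- (m + n) * q ^- n) q k * qpoch s' q k)
    * (qpoch (q ^+ l * a) q l * qpoch (sq * sa / sc) q l / qpoch (q ^+ l * (a / c)) q l * S
       / qpoch s q l)); last by rewrite !invfM; ring.
  rewrite -rk.
  have qpochs4 x y z w : qpochs [:: x; y; z; w] q k
      = qpoch x q k * qpoch y q k * qpoch z q k * qpoch w q k.
    by rewrite /qpochs !big_cons big_nil mulr1 !mulrA.
  rewrite !qpochs4.
  have -> : q ^ (- n%:Z) = q ^- n by rewrite exprnN.
  have -> : q ^ (- m%:Z - n%:Z) = q ^- (m + n).
    by rewrite (@exprz_subn _ _ q0 _ 0 (m + n)) ?expr0 ?mul1r //; lia.
  have -> : q ^ (- m%:Z - (2 * n)%:Z) = q ^- (m + n) * q ^- n.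
    by rewrite (@exprz_subn _ _ q0 _ 0 (m + n + n)) ?expr0 ?mul1r ?exprD ?invfM //; lia.
  rewrite (canRL (mulKf (sk k kn)) ss) -/s' !invfM.
  have := sk k kn; have := s'k k (leq_trans kn (leq_addl _ _)); move: sl.
  move: (qpoch s q l) (qpoch s q k) (qpoch s' q k) => x y z x0 z0 y0.
  move: (qpoch q q k)^-1 (qpoch (- s') q k)^-1 (qpoch (_ * _) q k)^-1 => X Y Z.
  by field; rewrite x0 y0 z0.
under eq_bigr => k _ do rewrite mulrCA big_distrr.
rewrite -big_distrr; congr (_ * _); rewrite exchange_big /=.
apply: eq_big_nat => i /andP[_ il].
(* The product of the shifted parameters does not depend on i, so the same s' serves in
   [watson_expansion] for every i. *)
have ea : q * (q ^+ (2 * l - i) * a) * (q ^+ i * c) = q ^+ (1 + 2 * l) * a * c.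
  have -> : (1 + 2 * l = 1 + (2 * l - i) + i)%N by lia.
  by rewrite !exprD; ring.
rewrite -watson_expansion //.
- by rewrite big_distrr; apply: eq_bigr => k _ /=; rewrite !invfM; ring.
- by rewrite ea /s' exprMn s2 exprD mul2n -addnn exprD; ring.
- by move=> k kM; rewrite ea; apply: hac.
Qed.
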